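(* Let $X$ be a complex Banach space, $T\in\mathcal{L}(X)$ power-bounded, and let $F\in\mathbb{P}(\mathbb{Z}^+)$ be aperiodic. Then $$\sup_{n\in\mathbb{N}} n^{1/2}\|\Psi(F;T)^n-\Psi(F;T)^{n+1}\|<\infty,$$ and there exists $\beta\in(0,1)$ such that $$\sigma(\Psi(F;T))\subseteq\{z\in\mathbb{C}:|z-(1-\beta)|\le\beta\}\subseteq\mathbb{D}\cup\{1\}.$$
   Context: $T$ is power-bounded if $\sup_{n\in\mathbb{N}}\|T^n\|<\infty$. $\mathbb{P}(\mathbb{Z})$ is the set of probabilities on $\mathbb{Z}$ (functions $F:\mathbb{Z}\to[0,1]$ with $\sum_kF(k)=1$), $\mathbb{P}(\mathbb{Z}^+)$ those supported in $\mathbb{Z}^+=\{0,1,2,\dots\}$. $F\in\mathbb{P}(\mathbb{Z})$ is adapted if $\mathrm{supp}(F)=\{k:F(k)\ne0\}$ generates the additive group $\mathbb{Z}$, and aperiodic if every translate $\delta_m*F$ ($m\in\mathbb{Z}$) is adapted, where $\delta_m$ is the point mass at $m$ and $*$ is convolution. $\Psi(F;T)=\sum_{k\ge0}F(k)T^k$ with $T^0=I$. $\mathbb{D}=\{|z|<1\}$. *)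

(* Defs.v *)
From HB Require Import structures.
From mathcomp Require Import all_boot all_order all_algebra.
From mathcomp Require Import all_classical all_reals all_analysis.
From mathcomp Require Import complex.
Set Implicit Arguments. Unset Strict Implicit. Unset Printing Implicit Defensive.
Import Order.TTheory GRing.Theory Num.Theory.
Import numFieldNormedType.Exports.
Local Open Scope classical_set_scope.
Local Open Scope ring_scope.
Local Open Scope complex_scope.

Definition generates_Z (S : set int) : Prop :=
  forall G : set int,
    G 0 -> (forall a b, G a -> G b -> G (a - b)) -> S `<=` G -> G = setT.

Definition is_prob_Z (R : realType) (F : int -> R) : Prop :=
  (forall k, 0 <= F k) /\ (fun N : nat => \sum_(0 <= i < N.*2) F (i%:Z - N%:Z)) @ \oo --> (1 : R).

Definition is_prob_Zplus (R : realType) (F : int -> R) : Prop :=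
  is_prob_Z F /\ (forall k : int, k < 0 -> F k = 0).

Definition supp (R : realType) (F : int -> R) : set int := [set k | F k != 0].

Definition adapted (R : realType) (F : int -> R) : Prop := generates_Z (supp F).

(* delta_m * F is the translate k |-> F (k - m) *)
Definition aperiodic (R : realType) (F : int -> R) : Prop :=
  forall m : int, adapted (fun k => F (k - m)).

Definition power_bounded (R : realType) (X : normedModType R[i]) (T : X -> X) : Prop :=
  exists M : R, forall (n : nat) (x : X), `|iter n T x| <= M%:C * `|x|.

Definition Psi (R : realType) (X : normedModType R[i]) (F : int -> R) (T : X -> X) : X -> X :=
  fun x => limn (fun N : nat => \sum_(0 <= k < N) ((F k%:Z)%:C *: iter k T x)).

Definition spectrum (R : realType) (X : normedModType R[i]) (A : X -> X) : set R[i] :=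
  [set l | ~ exists B : {linear X -> X}, continuous B /\
       (forall x, B (l *: x - A x) = x) /\ (forall x, l *: B x - A (B x) = x)].

(* Main.v *)
Require Import Defs.
From HB Require Import structures.
From mathcomp Require Import all_boot all_order all_algebra.
From mathcomp Require Import all_classical all_reals all_analysis.
From mathcomp Require Import complex.
From mathcomp Require Import ring lra zify.
Import Order.TTheory GRing.Theory Num.Theory.
Import numFieldNormedType.Exports.
Local Open Scope classical_set_scope.
Local Open Scope ring_scope.
Local Open Scope complex_scope.

(** For the equivalent norm [p x = sup_n |T^n x|] both [T] and [Q = Psi(F;T)] are
    contractions, and removing an atom [F(s) T^s] from [Q] leaves an operator of
    [p]-norm at most [1 - F(s)]; this stands in for positivity of convolution
    powers.  Aperiodicity yields [u] and [k] with [u] in the supports of both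
    [F^{*k}] and [F^{*(k+1)}], so that [Q^(k+1) = (c/2) T^u (I + Q) + G] with [G] of
    [p]-norm at most [1 - c].  As [|(I + Q)^i (I - Q)| = O(2^i i^(-1/2))], the powers
    of [Q^(k+1)] times [I - Q] decay like [n^(-1/2)]; no moment of [F] is needed since
    everything is expanded in [Q] and not in [T].

    If [l] is in the spectrum of [Q], then [l^n (1 - l)] is in that of [Q^n - Q^(n+1)],
    so [n^(1/2) |l|^n |1 - l|] is bounded; taking [n] of order [1 / (1 - |l|)] gives
    [|1 - l|^2 <= K (1 - |l|)], which for [(1 - beta) K = beta] implies membership
    in the disc of centre [1 - beta] and radius [beta]. *)

Set Implicit Arguments.
Unset Strict Implicit.

(** * Binomial sums *)

Section BinomialSum.
Variable V : zmodType.

(** This is [((1 + E)^n g) 0] for the shift [E]; values in a group cover both real moments and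
    orbits of an operator. *)
Definition binsum n (g : nat -> V) := \sum_(k < n.+1) g k *+ 'C(n, k).

Lemma binsumS n g : binsum n.+1 g = binsum n g + binsum n (g \o S).
Proof.
rewrite /binsum big_ord_recl bin0 /=.
under eq_bigr => i _ do rewrite /bump /= add1n binS mulrnDr.
rewrite big_split /= addrA; congr (_ + _).
by rewrite big_ord_recr /= bin_small // mulr0n addr0 [RHS]big_ord_recl bin0.
Qed.

Lemma binsum0 g : binsum 0 g = g 0%N.
Proof. by rewrite /binsum big_ord1 bin0. Qed.

Lemma eq_binsum n g h : g =1 h -> binsum n g = binsum n h.
Proof. by move=> gh; apply: eq_bigr => k _; rewrite gh. Qed.

Lemma binsumD n g h : binsum n (fun k => g k + h k) = binsum n g + binsum n h.
Proof. by rewrite /binsum -big_split /=; apply: eq_bigr => k _; rewrite mulrnDl. Qed.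

End BinomialSum.

Section BinomialMoments.
Variable R : realFieldType.

(** Position of the simple random walk after [n] unit steps, [k] of them downwards. *)
Definition deviation n k : R := n%:R - k%:R *+ 2.

Lemma deviationSl n k : deviation n.+1 k = deviation n k + 1.
Proof. by rewrite /deviation -natr1; ring. Qed.

Lemma deviationSS n k : deviation n.+1 k.+1 = deviation n k - 1.
Proof. by rewrite /deviation -!natr1; ring. Qed.

Lemma binsum_cst n (a : R) : binsum n (fun=> a) = a * 2 ^+ n.
Proof.
elim: n => [|n IH]; first by rewrite binsum0 expr0 mulr1.
by rewrite binsumS (_ : _ \o S = fun=> a) // IH exprS; ring.
Qed.

Lemma binsumZ n (a : R) g : binsum n (fun k => a * g k) = a * binsum n g.
Proof. by rewrite /binsum mulr_sumr; apply: eq_bigr => k _; rewrite mulrnAr. Qed.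

Lemma ler_binsum n (g h : nat -> R) :
  (forall k, g k <= h k) -> binsum n g <= binsum n h.
Proof. by move=> gh; apply: ler_sum => k _; rewrite lerMn2r gh orbT. Qed.

(** Variance of the walk: a Pascal step turns [d^2] into [(d + 1)^2 + (d - 1)^2 = 2 d^2 + 2]. *)
Lemma binsum_deviation_sqr n :
  binsum n (fun k => deviation n k ^+ 2) = n%:R * 2 ^+ n.
Proof.
elim: n => [|n IH]; first by rewrite binsum0 /deviation; ring.
rewrite binsumS -binsumD.
rewrite (@eq_binsum _ _ _ (fun k => 2 * deviation n k ^+ 2 + 2)); last first.
  by move=> k /=; rewrite deviationSl deviationSS; ring.
by rewrite binsumD binsumZ IH binsum_cst -natr1 exprS; ring.
Qed.

End BinomialMoments.

(** Mean absolute deviation is at most standard deviation; this is the source of the exponent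
    [1/2]. *)
Lemma binsum_normr_deviation (R : rcfType) n :
  binsum n.+1 (fun k => `|deviation R n.+1 k|) <= Num.sqrt n.+1%:R * 2 ^+ n.+1.
Proof.
set t := Num.sqrt _.
have t0 : 0 < t by rewrite sqrtr_gt0 ltr0n.
have t2 : n.+1%:R = t ^+ 2 by rewrite sqr_sqrtr ?ler0n.
(* AM-GM: [|d| <= (d^2 / t + t) / 2] *)
apply: (@le_trans _ _ (binsum n.+1
  (fun k => (2 * t)^-1 * deviation R n.+1 k ^+ 2 + t / 2))).
  apply: ler_binsum => k; rewrite -(real_normK (num_real (deviation _ _ _))).
  set d := `|_|.
  rewrite -subr_ge0.
  have -> : (2 * t)^-1 * d ^+ 2 + t / 2 - d = (2 * t)^-1 * (d - t) ^+ 2.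
    by field; rewrite gt_eqF.
  by rewrite mulr_ge0 ?sqr_ge0 // invr_ge0 mulr_ge0 ?ler0n // ltW.
rewrite binsumD binsumZ binsum_deviation_sqr binsum_cst t2 le_eqVlt.
by apply/orP; left; apply/eqP; field; rewrite gt_eqF.
Qed.

(** Rearranged, [1/a - 1/d <= c (1/a - 1/b)]: the left side is at most [c / (16 a^3)], while
    [1/a - 1/b] is at least [1 / (6 a^3)]. This is the induction step of the decay estimate. *)
Lemma invsqrt_supersolution (R : rcfType) (c z : R) : 0 <= c <= 1 -> 1 <= z ->
  (1 - c) / Num.sqrt z + c / Num.sqrt (z + 1) <= (Num.sqrt (z + c / 8))^-1.
Proof.
move=> /andP[c0 c1] z1.
set a := Num.sqrt z; set b := Num.sqrt (z + 1); set d := Num.sqrt _.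
have a0 : 0 < a by rewrite sqrtr_gt0; lra.
have ab : a <= b by rewrite ler_sqrt; lra.
have ad : a <= d by rewrite ler_sqrt; lra.
have a2 : a ^+ 2 = z by rewrite sqr_sqrtr; lra.
have b2 : b ^+ 2 = z + 1 by rewrite sqr_sqrtr; lra.
have d2 : d ^+ 2 = z + c / 8 by rewrite sqr_sqrtr; lra.
(* [z >= 1] gives [z + 1 <= 4 z]; hence the constant [6 = 2 * (1 + 2)] below. *)
have ba : b <= 2 * a.
  by rewrite -(ler_pXn2r (n := 2)) ?nnegrE ?exprMn ?a2 ?b2 //; lra.
have b0 := lt_le_trans a0 ab; have d0 := lt_le_trans a0 ad.
have E1 : a^-1 - d^-1 = (c / 8) / (a * d * (a + d)).
  have -> : c / 8 = d ^+ 2 - a ^+ 2 by rewrite a2 d2; ring.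
  by field; rewrite !gt_eqF // addr_gt0.
have E2 : a^-1 - b^-1 = (a * b * (a + b))^-1.
  rewrite -[RHS]mul1r; have -> : 1 = b ^+ 2 - a ^+ 2 by rewrite a2 b2; ring.
  by field; rewrite !gt_eqF // addr_gt0.
have H1 : (c / 8) / (a * d * (a + d)) <= c / 8 * (a ^+ 3 * 2)^-1.
  apply: ler_wpM2l; first lra.
  rewrite lef_pV2 ?posrE ?mulr_gt0 ?exprn_gt0 ?addr_gt0 //.
  rewrite (_ : a ^+ 3 * 2 = a * a * (a + a)); last ring.
  apply: ler_pM; rewrite ?mulr_ge0 ?addr_ge0 // ?(ltW a0) ?(ltW d0) //.
    by rewrite ler_pM2l.
  by rewrite lerD2l.
have H2 : (a ^+ 3 * 6)^-1 <= (a * b * (a + b))^-1.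
  rewrite lef_pV2 ?posrE ?mulr_gt0 ?exprn_gt0 ?addr_gt0 //.
  rewrite (_ : a ^+ 3 * 6 = a * (2 * a) * (a + 2 * a)); last ring.
  apply: ler_pM; rewrite ?mulr_ge0 ?addr_ge0 // ?(ltW a0) ?(ltW b0) //.
    by rewrite ler_pM2l.
  by rewrite lerD2l.
have H3 : c / 8 * (a ^+ 3 * 2)^-1 <= c * (a ^+ 3 * 6)^-1.
  rewrite [leRHS](_ : _ = c / 8 * (a ^+ 3 * 2)^-1 * (8 / 3)); last first.
    by field; rewrite gt_eqF.
  rewrite -[leLHS]mulr1; apply: ler_wpM2l; last lra.
  by rewrite mulr_ge0 ?invr_ge0 ?mulr_ge0 ?exprn_ge0 ?(ltW a0) //; lra.
have H4 : c * (a ^+ 3 * 6)^-1 <= c * (a * b * (a + b))^-1 by apply: ler_wpM2l.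
have := le_trans H1 (le_trans H3 H4); rewrite -E1 -E2; lra.
Qed.

(** * Decay for contractions of a seminorm *)

Section IterLinear.
Variables (K : pzRingType) (X : lmodType K) (f : {linear X -> X}).

Lemma iter_linearD n : {morph iter n f : x y / x + y}.
Proof. by elim: n => // n IH x y; rewrite !iterS IH linearD. Qed.

Lemma iter_linearZ n a : {morph iter n f : x / a *: x}.
Proof. by elim: n => // n IH x; rewrite !iterS IH linearZ. Qed.

Lemma iter_linearB n : {morph iter n f : x y / x - y}.
Proof. by elim: n => // n IH x y; rewrite !iterS IH linearB. Qed.

End IterLinear.

Lemma iter_comm (T : Type) (f g : T -> T) n :
  (forall x, f (g x) = g (f x)) -> forall x, f (iter n g x) = iter n g (f x).
Proof. by move=> fg x; elim: n => // n IH; rewrite !iterS fg IH. Qed.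

Section Seminorm.
Variables (R : realType) (X : lmodType R[i]) (p : X -> R).

(** Values are in [R], and homogeneity is stated for real scalars: the binomial coefficients, the
    deviations and the values of [F] are all real. *)
Definition real_seminorm :=
  (forall x y, p (x + y) <= p x + p y) /\
  (forall (a : R) x, p (a%:C *: x) = `|a| * p x).

Hypothesis hp : real_seminorm.

Lemma seminormD x y : p (x + y) <= p x + p y. Proof. exact: hp.1. Qed.

Lemma seminormZ (a : R) x : p (a%:C *: x) = `|a| * p x. Proof. exact: hp.2. Qed.

Lemma seminorm0 : p 0 = 0.
Proof. by rewrite -(scale0r 0) (seminormZ 0) normr0 mul0r. Qed.

Lemma seminormN x : p (- x) = p x.
Proof.
have := seminormZ (-1) x.
by rewrite rmorphN1 scaleN1r normrN1 mul1r.
Qed.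

Lemma seminorm_ge0 x : 0 <= p x.
Proof. by have := seminormD x (- x); rewrite subrr seminorm0 seminormN; lra. Qed.

Lemma seminormMn x n : p (x *+ n) = p x *+ n.
Proof.
have := seminormZ n%:R x; rewrite rmorph_nat scaler_nat => ->.
by rewrite normr_nat mulr_natl.
Qed.

Lemma seminorm_sum (I : Type) (r : seq I) (P : pred I) (g : I -> X) :
  p (\sum_(i <- r | P i) g i) <= \sum_(i <- r | P i) p (g i).
Proof.
apply: (big_ind2 (fun x a => p x <= a)) => [|x a y b xa yb|//].
  by rewrite seminorm0.
by apply: le_trans (seminormD _ _) _; apply: lerD.
Qed.

Lemma seminorm_binsum n (g : nat -> X) : p (binsum n g) <= binsum n (p \o g).
Proof.
apply: le_trans (seminorm_sum _ _ _) _.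
by apply: ler_sum => k _; rewrite seminormMn.
Qed.

Lemma iter_contraction (f : X -> X) n :
  (forall x, p (f x) <= p x) -> forall x, p (iter n f x) <= p x.
Proof. by move=> pf x; elim: n => //= n IH; apply: le_trans (pf _) IH. Qed.

End Seminorm.

Section Decay.
Variables (R : realType) (X : lmodType R[i]) (p : X -> R).
Hypothesis hp : real_seminorm p.
Variable Q : {linear X -> X}.
Hypothesis pQ : forall x, p (Q x) <= p x.

Let U x := x + Q x.

Lemma iter_addid n x : iter n U x = binsum n (fun k => iter k Q x).
Proof.
elim: n x => [|n IH] x; first by rewrite binsum0.
rewrite iterSr IH binsumS -binsumD; apply: eq_binsum => k.
by rewrite iter_linearD /= -iterSr.
Qed.

(* The coefficients of (1 + q)^n (1 - q) are
   C(n, k) - C(n, k - 1) = C(n + 1, k) (n + 1 - 2k) / (n + 1). *)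
Lemma iter_addid_diff n x :
  n.+1%:R%:C *: iter n U (x - Q x) =
  binsum n.+1 (fun k => (deviation R n.+1 k)%:C *: iter k Q x).
Proof.
elim: n x => [|n IH] x.
  rewrite binsumS !binsum0 /= /deviation !mulr0n mul0rn subr0 !scale1r.
  by rewrite (_ : 1 - 1 *+ 2 = -1) ?rmorphN1 ?scaleN1r //; ring.
rewrite binsumS -binsumD.
rewrite (@eq_binsum _ _ _ (fun k => (deviation R n.+1 k)%:C *: iter k Q (U x)
                                   + iter k Q (x - Q x))); last first.
  move=> k; rewrite /= deviationSl deviationSS /U iter_linearD iter_linearB.
  rewrite -iterS iterSr.
  move: (deviation _ _ _) (iter k Q x) (iter k Q (Q x)) => d a b.
  rewrite rmorphD rmorphB rmorph1 scalerDr scalerDl scalerBl !scale1r.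
  by rewrite addrACA.
rewrite binsumD -IH -iter_addid -natr1 rmorphD rmorph1 scalerDl scale1r.
congr (_ *: _ + _); rewrite iterSr; congr (iter n U _).
by rewrite /U linearB linearD /= opprD addrACA.
Qed.

(** Each [iter k Q] is a contraction, so the identity above bounds [n + 1] times the left side by
    the first absolute moment of the walk. *)
Lemma seminorm_addid_diff n x :
  p (iter n U (x - Q x)) <= 2 ^+ n.+1 / Num.sqrt n.+1%:R * p x.
Proof.
have p0 := seminorm_ge0 hp.
have t0 : 0 < Num.sqrt n.+1%:R :> R by rewrite sqrtr_gt0 ltr0n.
rewrite -(ler_pM2l (x := n.+1%:R)) ?ltr0n //.
rewrite -[X in X * p _]ger0_norm ?ler0n // -seminormZ // iter_addid_diff.
apply: le_trans (seminorm_binsum hp _ _) _.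
apply: (@le_trans _ _ (binsum n.+1 (fun k => p x * `|deviation R n.+1 k|))).
  apply: ler_binsum => k /=; rewrite seminormZ // mulrC ler_wpM2r //.
  exact: iter_contraction.
rewrite binsumZ mulrC mulrA ler_wpM2r //.
apply: le_trans (binsum_normr_deviation _ _) _.
rewrite le_eqVlt; apply/orP; left; apply/eqP.
rewrite -[X in _ = X * _](@sqr_sqrtr _ n.+1%:R) ?ler0n //.
by field; rewrite gt_eqF.
Qed.

Variables (H V : X -> X) (c : R).
Hypothesis c01 : 0 <= c <= 1.
Hypothesis HU : forall x, H (U x) = U (H x).
Hypothesis pV : forall x, p (V x) <= p x.
Hypothesis pH : forall x, p (H x - (c / 2)%:C *: V (U x)) <= (1 - c) * p x.

(* Writing [H = (H - (c/2) V U) + (c/2) V U] bounds step [n + 1] at [i] by the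
   steps [n] at [i] and [i + 1]; the right-hand side is a supersolution of this
   recursion, so no binomial average over the powers of [U] is needed. *)
Lemma seminorm_domination_diff n i x :
  p (iter i U (iter n H (x - Q x)))
    <= 2 ^+ i.+1 / Num.sqrt (1 + i%:R + n%:R * (c / 8)) * p x.
Proof.
have p0 := seminorm_ge0 hp.
elim: n i => [|n IH] i.
  by rewrite mul0r addr0 /= nat1r; apply: seminorm_addid_diff.
have UH y : iter i U (H y) = H (iter i U y) by rewrite (iter_comm _ HU).
rewrite iterS UH.
set y := iter i U _.
have {1}-> : H y = (H y - (c / 2)%:C *: V (U y)) + (c / 2)%:C *: V (U y).
  by rewrite subrK.
apply: le_trans (seminormD hp _ _) _.
have pHy := pH y; have pVy := pV (U y).
have IH1 := IH i; have IH2 := IH i.+1; rewrite -/y iterS -/y in IH1 IH2.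
have [c0 c1] := andP c01.
rewrite seminormZ // ger0_norm ?divr_ge0 //.
set z := 1 + i%:R + n%:R * (c / 8).
have z1 : 1 <= z by rewrite /z -addrA lerDl addr_ge0 ?mulr_ge0 ?ler0n //; lra.
have := invsqrt_supersolution c01 z1.
rewrite (_ : 1 + i%:R + n.+1%:R * (c / 8) = z + c / 8); last first.
  by rewrite /z -natr1; ring.
move: IH1 IH2; rewrite -/z (_ : 1 + i.+1%:R + n%:R * (c / 8) = z + 1); last first.
  by rewrite /z -natr1; ring.
move=> IH1 IH2 S.
apply: le_trans (lerD pHy (ler_wpM2l _ (le_trans pVy IH2))) _; first lra.
apply: le_trans (lerD (ler_wpM2l _ IH1) (lexx _)) _; first lra.
have s0 w : 1 <= w -> Num.sqrt w != 0 :> R.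
  by move=> w1; rewrite gt_eqF // sqrtr_gt0; lra.
(* The extra factor 2 in the bound at [i + 1] cancels the half in [c / 2], leaving the weights
   [1 - c] and [c]. *)
rewrite [leLHS](_ : _ = 2 ^+ i.+1 *
    ((1 - c) / Num.sqrt z + c / Num.sqrt (z + 1)) * p x); last first.
  rewrite (exprS (2 : R) i.+1); move: (2 ^+ i.+1) => e.
  by field; rewrite !s0 //; lra.
by rewrite ler_wpM2r // ler_wpM2l ?exprn_ge0.
Qed.

End Decay.

(** * Atoms in the powers of [Q], and aperiodicity *)

Section Domination.
Variables (R : realType) (X : lmodType R[i]) (p : X -> R).
Hypothesis hp : real_seminorm p.
Variables T Q : {linear X -> X}.
Hypothesis pT : forall x, p (T x) <= p x.
Hypothesis pQ : forall x, p (Q x) <= p x.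

(** An atom of mass [q] contains one of any smaller mass [c]: the surplus [(q - c) W] is put back.
    It allows one common mass for two levels. *)
Lemma domination_le (H W : X -> X) (c q : R) x : 0 <= c <= q ->
  p (W x) <= p x ->
  p (H x - q%:C *: W x) <= (1 - q) * p x -> p (H x - c%:C *: W x) <= (1 - c) * p x.
Proof.
move=> /andP[c0 cq] Wx Hx.
have -> : H x - c%:C *: W x = (H x - q%:C *: W x) + (q - c)%:C *: W x.
  by rewrite rmorphB scalerBl addrA subrK.
apply: le_trans (seminormD hp _ _) _.
rewrite seminormZ // ger0_norm ?subr_ge0 //.
have : (q - c) * p (W x) <= (q - c) * p x by rewrite ler_wpM2l ?subr_ge0.
lra.
Qed.

(* Plays the role of [u] being in the support of the [k]-fold convolution power,
   when [Q] is a power series in [T] with probability coefficients. *)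
Definition dominates k u := exists2 q : R, 0 < q <= 1 &
  forall x, p (iter k Q x - q%:C *: iter u T x) <= (1 - q) * p x.

Lemma dominates0 : dominates 0 0.
Proof.
exists 1; first by rewrite ltr01 lexx.
by move=> x; rewrite scale1r subrr seminorm0 // subrr mul0r.
Qed.

(** From [Q^k Q^l - q r T^(u+v) = (Q^k - q T^u) Q^l + q T^u (Q^l - r T^v)], with norms
    [(1 - q) + q (1 - r) = 1 - q r]. *)
Lemma dominatesD k l u v : dominates k u -> dominates l v -> dominates (k + l) (u + v).
Proof.
move=> [q /andP[q0 q1] hq] [r /andP[r0 r1] hr]; exists (q * r).
  by rewrite mulr_gt0 //= mulr_ile1 // ltW.
move=> x; rewrite !iterD.
have -> : iter k Q (iter l Q x) - (q * r)%:C *: iter u T (iter v T x) =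
    (iter k Q (iter l Q x) - q%:C *: iter u T (iter l Q x)) +
    q%:C *: iter u T (iter l Q x - r%:C *: iter v T x).
  by rewrite iter_linearB scalerBr iter_linearZ scalerA -rmorphM addrA subrK.
apply: le_trans (seminormD hp _ _) _; rewrite seminormZ // (gtr0_norm q0).
have A : p (iter u T (iter l Q x - r%:C *: iter v T x)) <= (1 - r) * p x.
  exact: le_trans (iter_contraction _ pT _) (hr x).
have B : (1 - q) * p (iter l Q x) <= (1 - q) * p x.
  by rewrite ler_wpM2l ?subr_ge0 // (iter_contraction _ pQ).
have C := ler_wpM2l (ltW q0) A.
by apply: le_trans (lerD (le_trans (hq _) B) C) _; lra.
Qed.

Lemma dominates_decay k u : dominates k u -> dominates k.+1 u ->
  exists K : R, forall n x, Num.sqrt n%:R * p (iter n Q (x - Q x)) <= K * p x.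
Proof.
have p0 := seminorm_ge0 hp.
move=> [q /andP[q0 q1] hq] [r /andP[r0 r1] hr].
pose c := Num.min q r; pose m := k.+1.
have c0 : 0 < c by rewrite lt_min q0.
have cq : c <= q by rewrite ge_min lexx.
have cr : c <= r by rewrite ge_min lexx orbT.
have c1 : c <= 1 := le_trans cq q1.
pose H := iter m Q; pose V := iter u T.
have pV x : p (V x) <= p x by exact: iter_contraction.
have HU x : H (x + Q x) = H x + Q (H x).
  by rewrite /H iter_linearD -iterS iterSr.
(* Average of two estimates for [Q^(k+1)]: one removes [c T^u] at level [k + 1], the other removes
   [c T^u] at level [k] and multiplies by [Q]. *)
have pH x : p (H x - (c / 2)%:C *: V (x + Q x)) <= (1 - c) * p x.
  have A : p (H x - c%:C *: V x) <= (1 - c) * p x.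
    by apply: (@domination_le _ _ _ r); rewrite ?(ltW c0) //; apply: hr.
  have B : p (H x - c%:C *: V (Q x)) <= (1 - c) * p x.
    apply: (@domination_le _ (V \o Q) _ q); rewrite ?(ltW c0) //=.
      exact: le_trans (pV _) (pQ x).
    rewrite /H iterSr; apply: le_trans (hq (Q x)) _.
    by rewrite ler_wpM2l ?subr_ge0.
  have -> : H x - (c / 2)%:C *: V (x + Q x) =
      (2^-1 : R)%:C *: ((H x - c%:C *: V x) + (H x - c%:C *: V (Q x))).
    rewrite /V iter_linearD -/V addrACA -opprD -scalerDr scalerBr scalerA.
    rewrite -rmorphM [2^-1 * c]mulrC; congr (_ - _).
    rewrite -mulr2n -[H x *+ 2]scaler_nat scalerA -(rmorph_nat (real_complex R)).
    by rewrite -rmorphM mulVf ?scale1r.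
  rewrite seminormZ // ger0_norm ?invr_ge0 //.
  by have := seminormD hp (H x - c%:C *: V x) (H x - c%:C *: V (Q x)); lra.
have decay n x := seminorm_domination_diff hp pQ
  (introT andP (conj (ltW c0) c1)) HU pV pH n 0 x.
(* The 2 is [2^(i+1)] at [i = 0]. The root comes from [n <= m (1 + n %/ m)] and
   [1 + a <= (8 / c) (1 + a c / 8)]; the leftover [n %% m] powers of [Q] are contractions. *)
exists (2 * Num.sqrt (m%:R * (8 / c))) => n x.
rewrite {2}(divn_eq n m) addnC iterD mulnC.
have -> y : iter (m * (n %/ m))%N Q y = iter (n %/ m)%N H y.
  elim: (n %/ m)%N => [|j IH]; first by rewrite muln0.
  by rewrite mulnS iterD IH iterS.
set y := iter _ H _.
have Hy : p (iter (n %% m)%N Q y) <= 2 / Num.sqrt (1 + (n %/ m)%N%:R * (c / 8)) * p x.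
  apply: le_trans (iter_contraction _ pQ _) _.
  by have := decay (n %/ m)%N x; rewrite addr0 expr1.
have z1 : 1 <= 1 + (n %/ m)%N%:R * (c / 8).
  by rewrite lerDl mulr_ge0 // ?ler0n //; lra.
apply: le_trans (ler_wpM2l (sqrtr_ge0 _) Hy) _.
rewrite [leLHS]mulrA ler_wpM2r // mulrCA ler_wpM2l //.
rewrite ler_pdivrMr ?sqrtr_gt0; last lra.
rewrite -sqrtrM ?ler_sqrt ?mulr_ge0 ?ler0n ?invr_ge0 ?(ltW c0) //; try lra.
have nm : n%:R <= m%:R * (1 + (n %/ m)%N%:R) :> R.
  by rewrite nat1r -natrM ler_nat mulnC ltnW // ltn_ceil.
apply: le_trans nm _; rewrite -mulrA ler_wpM2l ?ler0n //.
set a := (n %/ m)%N%:R; have a0 : 0 <= a :> R by rewrite ler0n.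
have -> : 8 / c * (1 + a * (c / 8)) = 8 / c + a by field; rewrite gt_eqF.
by rewrite lerD2r ler_pdivlMr //; lra.
Qed.

(* The differences [u - v], where [u] and [v] are dominated at the same level [k],
   form a subgroup of [int] containing all [s - s0] with [s], [s0] in the support,
   hence everything; writing the element [s0] itself as such a difference puts
   [u = v + s0] at both levels [k] and [k + 1]. *)
Lemma aperiodic_dominates (F : int -> R) : aperiodic F ->
  (forall k, k < 0 -> F k = 0) ->
  (forall s : nat, F s%:Z != 0 -> dominates 1 s) ->
  exists k u, dominates k u /\ dominates k.+1 u.
Proof.
move=> aF F0 FS.
have {}FS (z : int) : F z != 0 -> exists2 s : nat, z = s%:Z & dominates 1 s.
  case: z => [s Fs|s]; first by exists s; [|apply: FS].
  by rewrite F0 ?eqxx // NegzE oppr_lt0.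
pose G : set int := [set d | exists k u v : nat,
  [/\ dominates k u, dominates k v & d = u%:Z - v%:Z]].
have G0 : G 0 by exists 0%N, 0%N, 0%N; split; rewrite ?subrr //; apply: dominates0.
have GB a b : G a -> G b -> G (a - b).
  move=> [k [u [v [ku kv ->]]]] [l [w [z [lw lz ->]]]].
  exists (k + l)%N, (u + z)%N, (v + w)%N; split; try exact: dominatesD.
  by rewrite !PoszD; ring.
(* With empty support the subgroup [{0}] would be all of [int]. *)
have [z Fz] : exists z, F z != 0.
  apply: contrapT => /forallNP F00.
  have : [set 0 : int] = setT.
    apply: (aF 0) => //= [a b -> ->|k]; first by rewrite subrr.
    by rewrite /supp /= subr0 => /F00.
  by move=> /(congr1 (fun A : set int => A 1)) /= E; have : 1 = 0 :> int by rewrite E.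
have [s0 zs0 d0] := FS z Fz.
have GT : G = setT.
  (* Translation by [- z] moves the atom [z = s0] to the origin, so the support becomes the set of
     differences [s - s0]. *)
  apply: (aF (- z)) => //= d; rewrite /supp /= opprK => /FS [s ds D].
  by exists 1%N, s, s0; split=> //; rewrite -ds -zs0 addrK.
have [k [u [v [ku kv E]]]] : G s0%:Z by rewrite GT.
have uv : u = (s0 + v)%N by lia.
by exists k, u; split=> //; rewrite uv -add1n; apply: dominatesD.
Qed.

End Domination.

(** * Bounded operators *)

Section RealNorm.
Variables (R : realType) (V : normedZmodType R[i]).

(** The norm is a real element of [R[i]]; its real part puts estimates in the ordered field [R]. *)
Definition rnorm (x : V) : R := complex.Re `|x|.

Lemma rnormE x : (rnorm x)%:C = `|x|.
Proof. by rewrite /rnorm RRe_real ?normr_real. Qed.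

Lemma rnorm_ge0 x : 0 <= rnorm x.
Proof. by rewrite -ler0c rnormE. Qed.

Lemma rnormD x y : rnorm (x + y) <= rnorm x + rnorm y.
Proof. by rewrite -lecR rmorphD /= !rnormE ler_normD. Qed.

Lemma rnorm0 : rnorm 0 = 0.
Proof. by rewrite /rnorm normr0. Qed.

Lemma rnormN x : rnorm (- x) = rnorm x.
Proof. by rewrite /rnorm normrN. Qed.

Lemma rnorm_sum (I : Type) (r : seq I) (P : pred I) (g : I -> V) :
  rnorm (\sum_(i <- r | P i) g i) <= \sum_(i <- r | P i) rnorm (g i).
Proof.
apply: (big_ind2 (fun x a => rnorm x <= a)) => [|x a y b xa yb|//].
  by rewrite rnorm0.
by apply: le_trans (rnormD _ _) _; apply: lerD.
Qed.

End RealNorm.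

Section Convergence.
Variables (R : realType) (X : completeNormedModType R[i]).

Lemma rnormZ (a : R[i]) (x : X) : rnorm (a *: x) = rnorm a * rnorm x.
Proof. by apply: complexI; rewrite rmorphM /= !rnormE normrZ. Qed.

Lemma rnorm_real (a : R) : rnorm a%:C = `|a|.
Proof. by rewrite /rnorm normc_def /= expr0n addr0 sqrtr_sqr. Qed.

Lemma rnorm_real_seminorm : real_seminorm (@rnorm R X).
Proof. by split=> [x y|a x]; rewrite ?rnormD // rnormZ rnorm_real. Qed.

Lemma cvgn_rnormP (u : nat -> X) (l : X) :
  u @ \oo --> l <->
  forall e : R, 0 < e -> exists N, forall n, (N <= n)%N -> rnorm (l - u n) <= e.
Proof.
split=> [/cvgrPdist_le ul e e0|ul].
  have [|N _ HN] := ul e%:C; first by rewrite ltcR.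
  by exists N => n /HN /=; rewrite -rnormE lecR.
apply/cvgrPdist_le => e; rewrite ltcE /= => /andP[/eqP e1 e0].
have [N HN] := ul _ e0; exists N => // n /= /HN.
by rewrite -lecR rnormE; congr (_ <= _); apply/eqP; rewrite eq_complex /= e1 !eqxx.
Qed.

(** Weierstrass test through the Cauchy criterion; completeness of [X] enters here. *)
Lemma summable_cvgn (u : nat -> X) (a : nat -> R) :
  (forall n, rnorm (u n) <= a n) -> cvgn (series a) -> cvgn (series u).
Proof.
move=> ua /cauchy_cvgP/cauchy_seriesP ca.
apply/cauchy_cvgP/cauchy_seriesP => e; rewrite ltcE /= => /andP[/eqP e1 e0].
apply: filterS (ca _ e0) => n /= an.
have -> : e = (complex.Re e)%:C by apply/eqP; rewrite eq_complex /= e1 !eqxx.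
rewrite -rnormE ltcR; apply: le_lt_trans an.
apply: le_trans (rnorm_sum _ _ _) _; apply: le_trans (ler_norm _).
by apply: ler_sum.
Qed.

Lemma cvgn_eq (u : nat -> X) (l l1 : X) : u @ \oo --> l -> u @ \oo --> l1 -> l = l1.
Proof. exact: (@cvg_unique X (@norm_hausdorff _ X)). Qed.

End Convergence.

Section BoundedOperator.
Variables (R : realType) (X : completeNormedModType R[i]).

(** A predicate on bare functions, so that composites and pointwise limits are built first and
    packed as linear maps afterwards. *)
Definition bounded_operator (f : X -> X) :=
  linear f /\ exists2 K : R, 0 <= K & forall x, rnorm (f x) <= K * rnorm x.

Lemma bounded_operator_comp f g :
  bounded_operator f -> bounded_operator g -> bounded_operator (f \o g).
Proof.
move=> [lf [K K0 fK]] [lg [L L0 gL]]; split=> [a x y|]; first by rewrite /= lg lf.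
exists (K * L) => [|x]; first exact: mulr_ge0.
by rewrite /= -mulrA; apply: le_trans (fK _) _; rewrite ler_wpM2l.
Qed.

Lemma bounded_operatorD f g :
  bounded_operator f -> bounded_operator g -> bounded_operator (fun x => f x + g x).
Proof.
move=> [lf [K K0 fK]] [lg [L L0 gL]]; split=> [a x y|].
  by rewrite /= lg lf scalerDr addrACA.
exists (K + L) => [|x]; first exact: addr_ge0.
by rewrite mulrDl; apply: le_trans (rnormD _ _) _; apply: lerD.
Qed.

Lemma bounded_operatorZ a f :
  bounded_operator f -> bounded_operator (fun x => a *: f x).
Proof.
move=> [lf [K K0 fK]]; split=> [b x y|].
  by rewrite lf scalerDr !scalerA mulrC.
exists (rnorm a * K) => [|x]; first by rewrite mulr_ge0 ?rnorm_ge0.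
by rewrite rnormZ -mulrA ler_wpM2l ?rnorm_ge0.
Qed.

Lemma bounded_operatorB f g :
  bounded_operator f -> bounded_operator g -> bounded_operator (fun x => f x - g x).
Proof.
move=> bf /(bounded_operatorZ (-1)) bg.
have := bounded_operatorD bf bg; congr bounded_operator.
by apply/funext => x; rewrite scaleN1r.
Qed.

Lemma bounded_operator0 : bounded_operator (fun=> 0).
Proof.
split=> [a x y|]; first by rewrite scaler0 addr0.
by exists 0 => // x; rewrite rnorm0 mul0r.
Qed.

Lemma bounded_operator_id : bounded_operator id.
Proof. by split=> //; exists 1 => // x; rewrite mul1r. Qed.

Lemma bounded_operator_iter f n : bounded_operator f -> bounded_operator (iter n f).
Proof.
move=> bf; elim: n => [|n]; first exact: bounded_operator_id.
exact: bounded_operator_comp.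
Qed.

Lemma bounded_operator_cvg f (u : nat -> X) (l : X) : bounded_operator f ->
  u @ \oo --> l -> (f \o u) @ \oo --> f l.
Proof.
move=> [lf [K K0 fK]] /cvgn_rnormP ul; apply/cvgn_rnormP => e e0.
(* [K] may be 0, so [K + 1] is the divisor. *)
have K1 : 0 < K + 1 by lra.
have [N HN] := ul (e / (K + 1)) (divr_gt0 e0 K1).
exists N => n /HN Hn /=.
have -> : f l - f (u n) = f (l - u n).
  by rewrite -[RHS]/(f (l - u n)) addrC -scaleN1r -lf scaleN1r addrC.
apply: le_trans (fK _) _; rewrite ler_pdivlMr // in Hn.
by apply: le_trans Hn; rewrite mulrC ler_wpM2l ?rnorm_ge0 //; lra.
Qed.

Lemma bounded_operator_linear f : bounded_operator f ->
  exists2 g : {linear X -> X}, g = f :> (X -> X) & continuous g.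
Proof.
move=> [lf [K K0 fK]].
pose g : {linear X -> X} :=
  HB.pack f (GRing.isLinear.Build R[i] X X *:%R f lf).
exists g => //; apply/bounded_linear_continuous/linear_boundedP.
exists K%:C; split=> [|r Kr x]; first by rewrite realE ler0c K0.
apply: le_trans (ler_wpM2r _ (ltW Kr)); last exact: normr_ge0.
by rewrite -!rnormE -rmorphM /= lecR fK.
Qed.

End BoundedOperator.

(** * Operator power series and the Neumann series *)

Section PowerSeries.
Variables (R : realType) (X : completeNormedModType R[i]).

Lemma rnormM : {morph (@rnorm R R[i]) : a b / a * b}.
Proof. by move=> a b; apply: complexI; rewrite rmorphM /= !rnormE normrM. Qed.

Lemma rnormX n : {morph (@rnorm R R[i]) : a / a ^+ n}.
Proof. by move=> a; apply: complexI; rewrite rmorphXn /= !rnormE normrX. Qed.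

Lemma rnormV : {morph (@rnorm R R[i]) : a / a^-1}.
Proof. by move=> a; apply: complexI; rewrite fmorphV /= !rnormE normfV. Qed.

Lemma cvgn_seminorm_le (p : X -> R) (M b : R) (u : nat -> X) (l : X) :
  real_seminorm p -> 0 <= M -> (forall x, p x <= M * rnorm x) ->
  u @ \oo --> l -> (exists N0, forall N, (N0 <= N)%N -> p (u N) <= b) -> p l <= b.
Proof.
move=> hp M0 pM /cvgn_rnormP ul [N0 HN0]; apply/ler_addgt0Pr => e e0.
have M1 : 0 < M + 1 by lra.
have [N HN] := ul (e / (M + 1)) (divr_gt0 e0 M1).
have := HN (maxn N N0) (leq_maxl _ _); have := HN0 (maxn N N0) (leq_maxr _ _).
set y := u _ => yb; rewrite ler_pdivlMr // => ly.
rewrite -(subrK y l) addrC; apply: le_trans (seminormD hp _ _) _.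
apply: lerD => //; apply: le_trans (pM _) _; apply: le_trans ly.
by rewrite mulrC ler_wpM2l ?rnorm_ge0 //; lra.
Qed.

(** Serves both [Psi] and the Neumann series; the commutation clause turns a right inverse into a
    left one. *)
Lemma power_series_operator (A : X -> X) (c : nat -> R[i]) (a : nat -> R) :
  bounded_operator A -> (forall k, 0 <= a k) ->
  (forall k x, rnorm (c k *: iter k A x) <= a k * rnorm x) -> cvgn (series a) ->
  exists S, [/\ bounded_operator S,
    forall x, (fun N => \sum_(0 <= k < N) c k *: iter k A x) @ \oo --> S x &
    forall L, bounded_operator L -> (forall x, L (A x) = A (L x)) ->
      forall x, L (S x) = S (L x)].
Proof.
move=> bA a0 Aa ca.
pose u x : nat -> X := fun N => \sum_(0 <= k < N) c k *: iter k A x.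
pose S x := limn (u x).
have uS x : u x @ \oo --> S x.
  have : cvgn (series (fun k => c k *: iter k A x)); last by [].
  apply: (@summable_cvgn _ _ _ (fun k => rnorm x * a k)) => [n|].
    by rewrite mulrC.
  exact: (@is_cvg_seriesZ _ _ (rnorm x)).
have uL L x N : bounded_operator L -> (forall x, L (A x) = A (L x)) ->
    L (u x N) = u (L x) N.
  move=> bL LA; have [g gL _] := bounded_operator_linear bL.
  rewrite -gL in LA *; rewrite /u linear_sum; apply: eq_bigr => k _.
  by rewrite linearZ /= (iter_comm _ LA).
have SL L : bounded_operator L -> (forall x, L (A x) = A (L x)) ->
    forall x, L (S x) = S (L x).
  move=> bL LA x; apply: (@cvgn_eq _ _ (u (L x))) => //.
  have <- : L \o u x = u (L x) by apply/funext => N; rewrite /= uL.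
  exact: bounded_operator_cvg (uS x).
exists S; split=> //; split=> [b x y|].
  apply: (@cvgn_eq _ _ (u (b *: x + y))) => //.
  have -> : u (b *: x + y) = (b \*: u x) + u y.
    apply/funext => N; rewrite -[RHS]/(b *: u x N + u y N) /u.
    rewrite scaler_sumr -big_split /=.
    apply: eq_bigr => k _.
    have [g gA _] := bounded_operator_linear bA; rewrite -gA.
    by rewrite iter_linearD iter_linearZ scalerDr !scalerA mulrC.
  exact: cvgD (cvgZr (uS x)) (uS y).
have ale n : series a n <= limn (series a).
  by apply: nondecreasing_cvgn_le ca n; apply: nondecreasing_series.
exists (limn (series a)) => [|x].
  by have := ale 0%N; rewrite /series /= big_geq.
apply: (@cvgn_seminorm_le _ 1 _ (u x) _ (rnorm_real_seminorm X)) => // [z|].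
  by rewrite mul1r.
exists 0%N => N _; apply: le_trans (rnorm_sum _ _ _) _.
apply: (@le_trans _ _ (series a N * rnorm x)).
  by rewrite /series /= mulr_suml; apply: ler_sum.
by rewrite ler_wpM2r ?rnorm_ge0.
Qed.

Lemma neumann_series (A : X -> X) (mu : R[i]) (a : R) :
  bounded_operator A -> (forall x, rnorm (A x) <= a * rnorm x) ->
  0 <= a -> a < rnorm mu ->
  exists B, [/\ bounded_operator B, forall x, B (mu *: x - A x) = x &
    forall x, mu *: B x - A (B x) = x].
Proof.
move=> bA Aa a0 amu; set m := rnorm mu in amu.
have m0 : 0 < m by apply: le_lt_trans amu.
have mu0 : mu != 0 by apply: contraTneq m0 => mu0; rewrite /m mu0 rnorm0 ltxx.
have q0 : 0 <= a / m by rewrite divr_ge0 // ltW.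
have q1 : `|a / m| < 1 by rewrite ger0_norm // ltr_pdivrMr // mul1r.
have An k x : rnorm (iter k A x) <= a ^+ k * rnorm x.
  elim: k => [|k IH]; first by rewrite mul1r.
  by rewrite iterS exprS -mulrA; apply: le_trans (Aa _) _; rewrite ler_wpM2l.
have [|||B [bB cB LB]] := @power_series_operator A (fun k => mu^-1 ^+ k.+1)
  (geometric m^-1 (a / m)) bA.
- by move=> k; rewrite /= mulr_ge0 ?exprn_ge0 ?invr_ge0 // ltW.
- move=> k x; rewrite rnormZ rnormX rnormV -/m /= exprS expr_div_n -exprVn.
  rewrite -!mulrA; apply: ler_wpM2l; first by rewrite invr_ge0 ltW.
  by rewrite mulrCA; apply: ler_wpM2l; rewrite ?exprn_ge0 ?invr_ge0 ?(ltW m0).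
- exact: is_cvg_geometric_series.
have bf : bounded_operator (fun x => mu *: x - A x).
  apply: bounded_operatorB => //; apply: bounded_operatorZ.
  exact: bounded_operator_id.
have [g gA _] := bounded_operator_linear bA.
have right_inv x : mu *: B x - A (B x) = x.
  apply: (cvgn_eq (bounded_operator_cvg bf (cB x))).
  apply/cvgn_rnormP => e e0.
  have x1 : 0 < rnorm x + 1 by have := rnorm_ge0 x; lra.
  have /cvgrPdist_le/(_ _ (divr_gt0 e0 x1))[N _ HN] := cvg_geometric (1 : R) q1.
  exists N => n /HN /=; rewrite mul1r sub0r normrN => Hn.
  (* Telescoping: the [n]-th partial sum leaves the residue [mu^-n A^n x]. *)
  have -> : x - (mu *: (\sum_(0 <= k < n) mu^-1 ^+ k.+1 *: iter k A x)
      - A (\sum_(0 <= k < n) mu^-1 ^+ k.+1 *: iter k A x)) = mu^-1 ^+ n *: iter n A x.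
    elim: n {Hn} => [|n IH].
      by rewrite big_geq // -gA !linear0 ?subrr ?subr0 ?addr0 expr0 scale1r subr0.
    rewrite big_nat_recr //= -gA [g (_ + _)]linearD [g (_ *: _)]linearZ /= gA.
    rewrite scalerDr scalerA exprS mulrA divff // mul1r -exprS.
    move: IH; move: (mu *: _) (A (\sum_(_ <= _ < _) _)) => y z <-.
    rewrite (opprD z) addrACA; move: (y - z) => w.
    by rewrite addrA [w + _]addrC subrK opprD opprK addrA subrr add0r.
  rewrite rnormZ rnormX rnormV -/m.
  apply: (@le_trans _ _ ((a / m) ^+ n * rnorm x)).
    rewrite exprMn [leRHS]mulrAC [leRHS]mulrC.
    by rewrite ler_wpM2l ?exprn_ge0 ?invr_ge0 ?(ltW m0).
  rewrite ler_pdivlMr // ger0_norm ?exprn_ge0 // in Hn.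
  apply: le_trans Hn; rewrite ler_wpM2l ?exprn_ge0 //; lra.
exists B; split=> // x; rewrite -[RHS](right_inv x).
symmetry; apply: (LB (fun x => mu *: x - A x) bf) => y.
by rewrite -gA [RHS]linearB [in RHS]linearZ.
Qed.

End PowerSeries.

(** * Spectrum *)

Lemma subrACA (V : zmodType) (x y z t : V) : (x - y) - (z - t) = (x - z) - (y - t).
Proof. by rewrite (opprD z) addrACA -(opprD y). Qed.

Section Spectrum.
Variables (R : realType) (X : completeNormedModType R[i]).
Variable Q : {linear X -> X}.
Hypothesis bQ : bounded_operator Q.
Implicit Types (l mu : R[i]) (a : R).

Lemma scale_sub_linearB l x y :
  l *: (x - y) - Q (x - y) = (l *: x - Q x) - (l *: y - Q y).
Proof. by rewrite scalerBr [Q (x - y)]linearB subrACA. Qed.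

(** Here [mu - A = (l - Q) D] is invertible with inverse [B], so [D B] is a right inverse of
    [l - Q]; as [D] commutes with [Q], [l - Q] is also injective, which makes the inverse
    two-sided. *)
Lemma not_spectrum_factor (D A : X -> X) l mu a :
  bounded_operator D -> (forall x, D (Q x) = Q (D x)) ->
  bounded_operator A -> (forall x, rnorm (A x) <= a * rnorm x) ->
  (forall x, mu *: x - A x = l *: D x - Q (D x)) ->
  0 <= a -> a < rnorm mu -> ~ spectrum Q l.
Proof.
move=> bD DQ bA Aa lD a0 amu sQ; apply: sQ.
have [B [bB Bl Br]] := neumann_series bA Aa a0 amu.
have [g gE gc] := bounded_operator_linear (bounded_operator_comp bD bB).
have [d dE _] := bounded_operator_linear bD.
have [b bE _] := bounded_operator_linear bB.
have Dr x : l *: D (B x) - Q (D (B x)) = x by rewrite -lD Br.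
exists g; split=> //; rewrite gE; split=> x; last exact: Dr.
set y := l *: x - Q x => /=.
apply/eqP; rewrite -subr_eq0; set w := _ - _.
have lw : l *: w - Q w = 0.
  by rewrite /w scale_sub_linearB Dr subrr.
have := Bl w; rewrite lD.
have -> : l *: D w - Q (D w) = D (l *: w - Q w).
  by rewrite -DQ -dE [RHS]linearB [d (l *: w)]linearZ.
by rewrite lw -dE linear0 -bE linear0 => <-.
Qed.

(** [D] is the geometric sum of the [l^(n-1-j) Q^j], built by [D_(n+1) = l D_n + Q^n]. *)
Lemma expn_factor l n : exists D : X -> X,
  [/\ bounded_operator D, forall x, D (Q x) = Q (D x) &
    forall x, l ^+ n *: x - iter n Q x = l *: D x - Q (D x)].
Proof.
elim: n => [|n [D [bD DQ lD]]].
  exists (fun=> 0); split; first exact: bounded_operator0.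
    by move=> x; rewrite linear0.
  by move=> x; rewrite expr0 scale1r subrr [Q 0]linear0 scaler0 subrr.
exists (fun x => l *: D x + iter n Q x); split.
- by apply: bounded_operatorD; [apply: bounded_operatorZ|apply: bounded_operator_iter].
- by move=> x; rewrite [RHS]linearD [Q (_ *: _)]linearZ DQ -iterSr.
- move=> x; rewrite [Q (_ + _)]linearD [Q (_ *: _)]linearZ /=.
  have /(congr1 (fun y => l *: y)) := lD x.
  rewrite !scalerBr scalerA -exprS scalerDr opprD addrACA => <-.
  by rewrite addrA subrK.
Qed.

Lemma spectrum_expn_le l n a : spectrum Q l -> 0 <= a ->
  (forall x, rnorm (iter n Q x) <= a * rnorm x) -> rnorm l ^+ n <= a.
Proof.
move=> sl a0 Qa; rewrite leNgt; apply/negP => al.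
have [D [bD DQ lD]] := expn_factor l n.
apply: (not_spectrum_factor bD DQ _ Qa lD a0 _ sl); rewrite ?rnormX //.
exact: bounded_operator_iter.
Qed.

(** Subtracting the factorisations for [n] and [n + 1] shows that [l - Q] divides
    [l^n (1 - l) - (Q^n - Q^(n+1))]. *)
Lemma spectrum_expn_diff_le l n a : spectrum Q l -> 0 <= a ->
  (forall x, rnorm (iter n Q x - iter n.+1 Q x) <= a * rnorm x) ->
  rnorm l ^+ n * rnorm (1 - l) <= a.
Proof.
move=> sl a0 Qa; rewrite leNgt; apply/negP => al.
have [D [bD DQ lD]] := expn_factor l n.
have [D1 [bD1 D1Q lD1]] := expn_factor l n.+1.
apply: (@not_spectrum_factor (fun x => D x - D1 x) _ l (l ^+ n * (1 - l)) a
  _ _ _ Qa _ a0 _ sl).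
- exact: bounded_operatorB.
- by move=> x; rewrite DQ D1Q linearB.
- by apply: bounded_operatorB; apply: bounded_operator_iter.
- move=> x; rewrite scale_sub_linearB -lD -lD1.
  by rewrite [RHS]subrACA mulrBr mulr1 -exprSr scalerBl.
- by rewrite rnormM rnormX.
Qed.

End Spectrum.

(** * Stolz regions *)

Section Stolz.
Variable R : realType.
Implicit Types r d C M K beta : R.

Lemma bernoulli_ge r n : 0 <= r -> 1 + n%:R * (r - 1) <= r ^+ n.
Proof.
move=> r0; elim: n => [|n IH]; first by rewrite mul0r addr0 expr0.
rewrite exprS; apply: le_trans (ler_wpM2l r0 IH); rewrite -natr1.
have : 0 <= n%:R * (r - 1) ^+ 2 by rewrite mulr_ge0 ?ler0n ?sqr_ge0.
lra.
Qed.

Lemma expn_bounded_le1 r M : 0 <= r -> (forall n, r ^+ n <= M) -> r <= 1.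
Proof.
move=> r0 rM; rewrite leNgt; apply/negP => r1.
have M0 : 0 <= M by apply: le_trans (rM 0%N); rewrite expr0.
have h : 0 < r - 1 by rewrite subr_gt0.
have := archi_boundP (divr_ge0 M0 (ltW h)); rewrite ltr_pdivrMr //.
have := le_trans (bernoulli_ge (Num.bound (M / (r - 1))) r0) (rM _); lra.
Qed.

(** Squaring the bound and applying Bernoulli to [r^(2n)] gives [n (1 - 2 n e) d^2 <= C^2]; then [n]
    is chosen with [n e] between [1/8] and [1/4]. *)
Lemma expn_sqrt_stolz r d C : 0 <= r -> r <= 1 -> 0 <= d -> d <= 2 ->
  (forall n, Num.sqrt n%:R * (r ^+ n * d) <= C) ->
  d ^+ 2 <= (16 * C ^+ 2 + 32) * (1 - r).
Proof.
move=> r0 r1 d0 d2 rC; set e := 1 - r.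
have e0 : 0 <= e by rewrite subr_ge0.
have C2 : 0 <= C ^+ 2 by rewrite sqr_ge0.
have D2 : 0 <= d ^+ 2 by rewrite sqr_ge0.
have D4 : d ^+ 2 <= 4 by rewrite expr2; have := ler_pM d0 d0 d2 d2; lra.
have nC n : n%:R * (1 - n%:R * e *+ 2) * d ^+ 2 <= C ^+ 2.
  have := ler_pM _ _ (rC n) (rC n); rewrite -!expr2 => {}rC.
  apply: (le_trans _ (rC _ _)); rewrite ?mulr_ge0 ?sqrtr_ge0 ?exprn_ge0 //.
  rewrite exprMn sqr_sqrtr ?ler0n // exprMn mulrA ler_wpM2r // ler_wpM2l ?ler0n //.
  rewrite -exprM; have := bernoulli_ge (n * 2) r0; rewrite natrM /e; lra.
(* Away from the circle [d^2 <= 4 <= 32 e], whence the summand 32. *)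
have [e8|e8] := ltP (1 / 8) e.
  have : 0 <= C ^+ 2 * e by rewrite mulr_ge0.
  rewrite mulrDl; lra.
(* On the circle [n d^2 <= C^2] for all [n] forces [d = 0]. *)
have [e00|ne0] := eqVneq e 0.
  rewrite e00 mulr0 leNgt; apply/negP => dp.
  have := archi_boundP (divr_ge0 C2 D2); rewrite ltr_pdivrMr //.
  have := nC (Num.bound (C ^+ 2 / d ^+ 2)).
  by rewrite e00 mulr0 mul0rn subr0 mulr1; lra.
have ep : 0 < e by rewrite lt_def ne0.
have y0 : 0 <= (4 * e)^-1 by rewrite invr_ge0; lra.
have /andP[] := truncn_itv y0; set n := Num.trunc _; rewrite -[n.+1%:R]natr1.
have := nC n; set N := n%:R => HC HN1 HN2.
have E : (4 * e)^-1 * e = 1 / 4.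
  by rewrite invfM -mulrA mulVf // mulr1 mul1r.
have NE : N * e <= 1 / 4 by rewrite -E ler_wpM2r.
have NE2 : 1 / 8 <= N * e.
  have : (4 * e)^-1 * e < (N + 1) * e by rewrite ltr_pM2r.
  rewrite E; lra.
have N0 : 0 <= N by rewrite ler0n.
have A : N * d ^+ 2 <= C ^+ 2 * 2.
  have : N * d ^+ 2 * (1 / 2) <= N * (1 - N * e *+ 2) * d ^+ 2.
    rewrite mulrAC ler_wpM2r // ler_wpM2l //; lra.
  lra.
have B : N * d ^+ 2 * e <= C ^+ 2 * 2 * e by rewrite ler_wpM2r.
have : 1 / 8 * d ^+ 2 <= N * e * d ^+ 2 by rewrite ler_wpM2r.
lra.
Qed.

Lemma rnorm_sqr (z : R[i]) :
  rnorm z ^+ 2 = complex.Re z ^+ 2 + complex.Im z ^+ 2.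
Proof. by apply: complexI; rewrite add_Re2_Im2 rmorphXn /= rnormE. Qed.

(** Since [z - (1 - beta) = (1 - beta) (z - 1) + beta z], its squared modulus is [(1 - beta) |1 -
    z|^2 + beta |z|^2 - beta (1 - beta)]. *)
Lemma disc_rnormE (z : R[i]) beta : 0 < beta ->
  (`|z - (1 - beta)%:C| <= beta%:C) =
  ((1 - beta) * rnorm (1 - z) ^+ 2 <= beta * (1 - rnorm z ^+ 2)).
Proof.
move=> b0; rewrite -rnormE lecR -(ler_pXn2r (n := 2)) ?nnegrE ?rnorm_ge0 ?(ltW b0) //.
rewrite !rnorm_sqr; case: z => x y /=.
by apply/idP/idP; lra.
Qed.

End Stolz.

(** * Power series with probability coefficients *)

Section ProbabilityOnNat.
Variables (R : realType) (F : int -> R).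
Hypothesis pF : is_prob_Zplus F.

Lemma cvgn_prob_series : series (fun k : nat => F k%:Z) @ \oo --> (1 : R).
Proof.
have [[_ F1] Fneg] := pF.
rewrite (_ : series _ = fun N : nat => \sum_(0 <= i < N.*2) F (i%:Z - N%:Z)) //.
(* The first [N] terms of the symmetric window have negative arguments and vanish. *)
apply/funext => N; rewrite (@big_cat_nat _ _ _ N) //=; last by rewrite -addnn leq_addr.
rewrite [X in _ = X + _]big_nat_cond big1 ?add0r; last first.
  by move=> i /andP[/andP[_ iN] _]; apply: Fneg; lia.
rewrite -{2}[N]add0n big_addn -addnn addnK /series /=.
by apply: eq_bigr => k _; rewrite PoszD addrK.
Qed.

Lemma prob_series_le1 n : \sum_(0 <= k < n) F k%:Z <= 1.
Proof.
have <- : limn (series (fun k : nat => F k%:Z)) = 1.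
  by apply: cvg_lim => //; apply: cvgn_prob_series.
apply: (@nondecreasing_cvgn_le _ (series (fun k : nat => F k%:Z))).
  by apply: nondecreasing_series => k _ _; apply: pF.1.1.
by apply: cvgP cvgn_prob_series.
Qed.

End ProbabilityOnNat.

(** * The equivalent norm and subordination *)

Section OrbitNorm.
Variables (R : realType) (X : completeNormedModType R[i]) (T : {linear X -> X}).
Variable M : R.
Hypothesis M0 : 0 <= M.
Hypothesis TM : forall n x, rnorm (iter n T x) <= M * rnorm x.

Definition orbit_norm (x : X) : R := sup (range (fun n => rnorm (iter n T x))).

Lemma orbit_norm_ge n x : rnorm (iter n T x) <= orbit_norm x.
Proof.
apply: ub_le_sup; last by exists n.
by exists (M * rnorm x) => _ [k _ <-].
Qed.

Lemma orbit_norm_le x b : (forall n, rnorm (iter n T x) <= b) -> orbit_norm x <= b.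
Proof.
move=> xb; apply: ge_sup; first by exists (rnorm (iter 0 T x)), 0%N.
by move=> _ [k _ <-].
Qed.

Lemma orbit_norm_rnorm x : orbit_norm x <= M * rnorm x.
Proof. exact: orbit_norm_le. Qed.

Lemma rnorm_orbit_norm x : rnorm x <= orbit_norm x.
Proof. exact: (orbit_norm_ge 0). Qed.

Lemma orbit_norm_contraction x : orbit_norm (T x) <= orbit_norm x.
Proof. by apply: orbit_norm_le => n; rewrite -iterSr; apply: orbit_norm_ge. Qed.

Lemma orbit_norm_real_seminorm : real_seminorm orbit_norm.
Proof.
have Zle (a : R) x : orbit_norm (a%:C *: x) <= `|a| * orbit_norm x.
  apply: orbit_norm_le => n; rewrite iter_linearZ rnormZ rnorm_real.
  by rewrite ler_wpM2l // orbit_norm_ge.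
split=> [x y|a x].
  apply: orbit_norm_le => n; rewrite iter_linearD.
  by apply: le_trans (rnormD _ _) _; apply: lerD; apply: orbit_norm_ge.
apply/eqP; rewrite eq_le Zle /=.
have [->|a0] := eqVneq a 0.
  by rewrite normr0 mul0r; apply: le_trans (rnorm_orbit_norm _); apply: rnorm_ge0.
(* The reverse inequality is the same bound for the inverse scalar. *)
have := Zle a^-1 (a%:C *: x).
rewrite scalerA -rmorphM mulVf //= scale1r normfV mulrC.
by rewrite ler_pdivlMr ?normr_gt0 // mulrC.
Qed.

Lemma power_bounded_operator : bounded_operator T.
Proof.
split; first exact: linearP.
by exists M => // x; apply: (TM 1).
Qed.

Section Subordination.
Variable F : int -> R.
Hypothesis pF : is_prob_Zplus F.

Lemma Psi_operator : exists Q : {linear X -> X}, [/\ Q = Psi F T :> (X -> X),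
  bounded_operator Q &
  forall x, (fun N => \sum_(0 <= k < N) (F k%:Z)%:C *: iter k T x) @ \oo --> Q x].
Proof.
have F0 := pF.1.1.
have [|||S [bS cS _]] := @power_series_operator _ _ T (fun k => (F k%:Z)%:C)
  (fun k => M * F k%:Z) power_bounded_operator.
- by move=> k; rewrite mulr_ge0.
- move=> k x; rewrite rnormZ rnorm_real ger0_norm // [M * _]mulrC -mulrA.
  by rewrite ler_wpM2l ?TM.
- by apply: (@is_cvg_seriesZ _ _ M); apply: cvgP (cvgn_prob_series pF).
have [Q QS _] := bounded_operator_linear bS.
exists Q; rewrite QS; split=> //.
by apply/funext => x; apply/esym/cvg_lim => //; apply: cS.
Qed.

(** The remaining coefficients are nonnegative with sum at most [1 - F s], and each power of [T]
    contracts the orbit norm. *)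
Lemma Psi_remove_atom (Q : {linear X -> X}) (s : nat) x :
  (fun N => \sum_(0 <= k < N) (F k%:Z)%:C *: iter k T x) @ \oo --> Q x ->
  orbit_norm (Q x - (F s%:Z)%:C *: iter s T x) <= (1 - F s%:Z) * orbit_norm x.
Proof.
have F0 := pF.1.1; have hp := orbit_norm_real_seminorm.
move=> Qx; set y := _ *: iter s T x.
have Qy : (fun N => \sum_(0 <= k < N) (F k%:Z)%:C *: iter k T x - y) @ \oo --> Q x - y.
  by apply: cvgB => //; apply: cvg_cst.
apply: (cvgn_seminorm_le hp M0 orbit_norm_rnorm Qy).
(* From [s + 1] on, the partial sums contain the atom. *)
exists s.+1 => N sN.
have sum_rem (V : zmodType) (g : nat -> V) :
    \sum_(0 <= k < N) g k - g s = \sum_(0 <= k < N | k != s) g k.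
  by rewrite (bigD1_seq s) ?iota_uniq ?mem_index_iota //= addrAC subrr add0r.
rewrite sum_rem; apply: le_trans (seminorm_sum hp _ _ _) _.
apply: (@le_trans _ _ (\sum_(0 <= k < N | k != s) F k%:Z * orbit_norm x)).
  apply: ler_sum => k _; rewrite hp.2 ger0_norm // ler_wpM2l //.
  exact: (iter_contraction _ orbit_norm_contraction).
rewrite -mulr_suml -sum_rem ler_wpM2r ?lerD2r ?(prob_series_le1 pF) //.
exact: seminorm_ge0.
Qed.

End Subordination.
End OrbitNorm.

Set Strict Implicit.
Unset Implicit Arguments.

(** * The decay rate and the location of the spectrum *)

Theorem theorem3p2 (R : realType) (X : completeNormedModType R[i])
    (T : {linear X -> X}) (F : int -> R) :
  continuous T -> power_bounded T ->
  is_prob_Zplus F -> aperiodic F ->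
  (exists M : R, forall (n : nat) (x : X),
     (Num.sqrt (n%:R : R))%:C * `|iter n (Psi F T) x - iter n.+1 (Psi F T) x|
       <= M%:C * `|x|)
  /\
  (exists beta : R, 0 < beta < 1 /\
     spectrum (Psi F T) `<=` [set z : R[i] | `|z - (1 - beta)%:C| <= beta%:C] /\
     [set z : R[i] | `|z - (1 - beta)%:C| <= beta%:C] `<=` [set z | `|z| < 1 \/ z = 1]).
Proof.
move=> _ [M1 TM1] pF aF.
(* On a trivial space the given constant may be negative. *)
pose M := Num.max M1 0.
have M0 : 0 <= M by rewrite le_max lexx orbT.
have TM n x : rnorm (iter n T x) <= M * rnorm x.
  rewrite -lecR rmorphM /= !rnormE; apply: le_trans (TM1 n x) _.
  by rewrite ler_wpM2r // lecR le_max lexx.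
have [Q [QPsi bQ cQ]] := Psi_operator M0 TM pF.
rewrite -QPsi.
pose p := orbit_norm T.
have hp : real_seminorm p := orbit_norm_real_seminorm TM.
have pT x : p (T x) <= p x := orbit_norm_contraction TM x.
have F0 := pF.1.1.
have Qatom (s : nat) x := Psi_remove_atom M0 TM pF (Q := Q) s (cQ x).
have Fle1 (s : nat) : F s%:Z <= 1.
  have := prob_series_le1 pF s.+1; rewrite big_nat_recr //=; apply: le_trans.
  by rewrite lerDr sumr_ge0.
have pQ x : p (Q x) <= p x.
  (* Removing the atom at 0 and putting it back gives [(1 - F 0) + F 0 = 1], even if [F 0 = 0]. *)
  rewrite -[Q x](subrK ((F 0)%:C *: x)); apply: le_trans (seminormD hp _ _) _.
  by rewrite hp.2 ger0_norm //; have := Qatom 0%N x; rewrite -/p; lra.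
have Qdom (s : nat) : F s%:Z != 0 -> dominates p T Q 1 s.
  move=> Fs; exists (F s%:Z); last exact: Qatom.
  by rewrite lt_def Fs F0 Fle1.
have [k [u [ku ku1]]] := aperiodic_dominates hp pT pQ aF pF.2 Qdom.
have [K QK] := dominates_decay hp pT pQ ku ku1.
pose C := Num.max K 0 * M.
have C0 : 0 <= C by rewrite mulr_ge0 // le_max lexx orbT.
have QC n x : Num.sqrt n%:R * rnorm (iter n Q x - iter n.+1 Q x) <= C * rnorm x.
  rewrite iterSr -iter_linearB.
  apply: le_trans (ler_wpM2l (sqrtr_ge0 _) (rnorm_orbit_norm TM _)) _.
  apply: le_trans (QK n x) _.
  apply: (@le_trans _ _ (Num.max K 0 * p x)).
    by rewrite ler_wpM2r ?(seminorm_ge0 hp) // le_max lexx.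
  rewrite /C -mulrA ler_wpM2l ?le_max ?lexx ?orbT //.
  exact: orbit_norm_rnorm.
have QM n x : rnorm (iter n Q x) <= M * rnorm x.
  apply: le_trans (rnorm_orbit_norm TM _) _.
  exact: le_trans (iter_contraction n pQ x) (orbit_norm_rnorm TM x).
split.
  exists C => n x.
  by rewrite -!rnormE -!rmorphM /= lecR.
pose K1 := 16 * C ^+ 2 + 32.
have K10 : 0 < K1 by rewrite /K1; have := sqr_ge0 C; lra.
pose beta := K1 / (1 + K1).
have b0 : 0 < beta by rewrite divr_gt0 //; lra.
have b1 : beta < 1 by rewrite ltr_pdivrMr; lra.
have bK : (1 - beta) * K1 = beta by rewrite /beta; field; lra.
exists beta; split; first by rewrite b0.
split=> [l sl|z] /=; rewrite disc_rnormE //.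
  have r0 := rnorm_ge0 l.
  have r1 : rnorm l <= 1.
    by apply: (@expn_bounded_le1 _ _ M) => // n; apply: spectrum_expn_le sl M0 (QM n).
  have d2 : rnorm (1 - l) <= 2.
    by apply: le_trans (rnormD _ _) _; rewrite rnormN (rnorm_real 1) normr1; lra.
  have := @expn_sqrt_stolz _ _ _ C r0 r1 (rnorm_ge0 _) d2.
  have rC n : Num.sqrt n%:R * (rnorm l ^+ n * rnorm (1 - l)) <= C.
    case: n => [|n]; first by rewrite sqrtr0 mul0r.
    have s0 : 0 < Num.sqrt n.+1%:R :> R by rewrite sqrtr_gt0 ltr0n.
    rewrite mulrC -ler_pdivlMr //; apply: (spectrum_expn_diff_le bQ sl).
      by rewrite divr_ge0 // ltW.
    by move=> x; rewrite mulrAC ler_pdivlMr // mulrC.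
  move=> /(_ rC) dK.
  (* With [d = |1 - l|] and [r = |l|]: [(1 - beta) d^2 <= (1 - beta) K1 (1 - r) = beta (1 - r) <=
     beta (1 - r^2)]. *)
  apply: (@le_trans _ _ ((1 - beta) * (K1 * (1 - rnorm l)))).
    by rewrite ler_wpM2l //; lra.
  rewrite mulrA bK ler_wpM2l ?(ltW b0) // lerD2l lerN2.
  by rewrite expr2 ler_piMl.
move=> zd.
have r0 := rnorm_ge0 z.
have d0 : 0 <= (1 - beta) * rnorm (1 - z) ^+ 2 by rewrite mulr_ge0 ?sqr_ge0 //; lra.
have r2 : 0 <= 1 - rnorm z ^+ 2 by rewrite -(pmulr_rge0 _ b0); apply: le_trans zd.
have [r1|r1] := ltP (rnorm z) 1; [left|right].
  by rewrite -rnormE ltcR.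
have r21 : 1 <= rnorm z ^+ 2 by rewrite exprn_ege1.
(* On the unit circle the right side of the disc inequality is at most 0, so [z = 1]. *)
have : (1 - beta) * rnorm (1 - z) ^+ 2 = 0.
  apply/eqP; rewrite eq_le d0 andbT.
  by apply: le_trans zd _; rewrite pmulr_rle0 //; lra.
move/eqP; rewrite mulf_eq0 sqrf_eq0 => /orP[/eqP b10|/eqP d1]; first by exfalso; lra.
by apply/esym/eqP; rewrite -subr_eq0 -normr_eq0 -rnormE d1.
Qed.
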